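(* Let $\{(Z^n,W^{n+1/2},R^n,\mathbf{U}^n,P^{n+1/2})\}$, with $\mathbf{U}^n=(U_1^n,U_2^n)$, be a solution of the fully discrete SAV-MAC scheme described in the context. Then the scheme is unconditionally energy stable in the sense that, for all $h,k,\Delta t>0$ and every $0\le n\le N-1$, $$\tilde E^{n+1}(Z,\mathbf{U},R)-\tilde E^{n}(Z,\mathbf{U},R)=-M\Delta t\,\|\mathbf{D}W^{n+1/2}\|_{l^2}^2-\nu\Delta t\,\|D\mathbf{U}^{n+1/2}\|^2,$$ where $$\tilde E^{n}(Z,\mathbf{U},R)=\tfrac12\|\mathbf{U}^{n}\|_{l^2}^2+\lambda\left(\tfrac12\|\mathbf{D}Z^{n}\|_{l^2}^2+(R^{n})^2\right).$$
   Context: Constants: $M,\nu,\lambda,\epsilon,\delta>0$, $\gamma\in\{0,1\}$; $F(\phi)=\frac{1}{4\epsilon^2}(1-\phi^2)^2$. Grid. $\Omega=(L_{lx},L_{rx})\times(L_{ly},L_{ry})$ with uniform nodes $x_i=L_{lx}+ih$ ($0\le i\le N_x$, $h=(L_{rx}-L_{lx})/N_x$), $y_j=L_{ly}+jk$ ($0\le j\le N_y$, $k=(L_{ry}-L_{ly})/N_y$). Midpoints: $x_{i+1/2}=(x_i+x_{i+1})/2$, $y_{j+1/2}=(y_j+y_{j+1})/2$; by convention $x_{-1/2}=x_0$, $x_{N_x+1/2}=x_{N_x}$, $y_{-1/2}=y_0$, $y_{N_y+1/2}=y_{N_y}$. Local widths: $h_i=x_{i+1/2}-x_{i-1/2}$,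 $k_j=y_{j+1/2}-y_{j-1/2}$ (so $h_i=h$, $k_j=k$ in the interior, $h_0=h_{N_x}=h/2$, $k_0=k_{N_y}=k/2$). $f_{l,m}$ denotes the value at $(x_l,y_m)$. Differences: $[d_xf]_{i+1/2,m}=\frac{f_{i+1,m}-f_{i,m}}{h}$, $[D_xf]_{i,m}=\frac{f_{i+1/2,m}-f_{i-1/2,m}}{h_i}$, $[d_yf]_{l,j+1/2}=\frac{f_{l,j+1}-f_{l,j}}{k}$, $[D_yf]_{l,j}=\frac{f_{l,j+1/2}-f_{l,j-1/2}}{k_j}$. Inner products: $(f,g)_{l^2,M}=\sum_{i=0}^{N_x-1}\sum_{j=0}^{N_y-1}hk\,f_{i+1/2,j+1/2}g_{i+1/2,j+1/2}$, $(f,g)_{l^2,T,M}=\sum_{i=1}^{N_x-1}\sum_{j=0}^{N_y-1}h_ik\,f_{i,j+1/2}g_{i,j+1/2}$, $(f,g)_{l^2,M,T}=\sum_{i=0}^{N_x-1}\sum_{j=1}^{N_y-1}hk_j\,f_{i+1/2,j}g_{i+1/2,j}$, $(f,g)_{l^2,T_x}=\sum_{i=0}^{N_x}\sum_{j=1}^{N_y-1}h_ik_jf_{i,j}g_{i,j}$, $(f,g)_{l^2,T_y}=\sum_{i=1}^{N_x-1}\sum_{j=0}^{N_y}h_ik_jf_{i,j}g_{i,j}$, with norms $\|f\|_{l^2,\xi}^2=(f,f)_{l^2,\xi}$. For a cell-centered scalar $H$: $\mathbf{D}H=(D_xH,D_yH)$, $\|\mathbf{D}H\|_{l^2}^2=\|D_xH\|_{l^2,T,M}^2+\|D_yH\|_{l^2,M,T}^2$.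 For $\mathbf{u}=(u_1,u_2)$: $\|\mathbf{u}\|_{l^2}^2=\|u_1\|_{l^2,T,M}^2+\|u_2\|_{l^2,M,T}^2$ and $\|D\mathbf{u}\|^2=\|d_xu_1\|_{l^2,M}^2+\|D_yu_1\|_{l^2,T_y}^2+\|D_xu_2\|_{l^2,T_x}^2+\|d_yu_2\|_{l^2,M}^2$. Interpolation. $\mathcal{P}_h^x$ and $\mathcal{P}_h^y$ are linear interpolation (averaging of the two neighbouring values) in $x$ and $y$ between integer and half-integer positions. In $\mathcal{P}_h^y\mathcal{P}_h^x[U_1D_x\tilde Z+U_2D_y\tilde Z]$ the result is a cell-centered quantity: $U_1D_x\tilde Z$, living at $(x_i,y_{j+1/2})$, is averaged in $x$, and $U_2D_y\tilde Z$, living at $(x_{i+1/2},y_j)$, is averaged in $y$. Time. $\Delta t=T/N$, $[d_tf]^{n}=(f^n-f^{n-1})/\Delta t$, $f^{n+1/2}=(f^n+f^{n+1})/2$, $\tilde H^{n+1/2}=\frac32H^n-\frac12H^{n-1}$; $W$ and $P$ enter only through the half-level unknowns $W^{n+1/2},P^{n+1/2}$. The starting values $Z^{-1}$ and $\mathbf{U}^{-1}=\mathbf{U}^0$ are prescribed. Unknown locations: $Z,W,P$ at $(x_{i+1/2},y_{j+1/2})$; $U_1$ at $(x_i,y_{j+1/2})$; $U_2$ at $(x_{i+1/2},y_j)$; $R^n\in\mathbb{R}$. $E_1^h(Z)=(F(Z),1)_{l^2,M}$. Boundary conditions: $D_xZ^n,D_xW^{n+1/2}$ vanish at $i=0,N_x$;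 $D_yZ^n,D_yW^{n+1/2}$ vanish at $j=0,N_y$; $U_1^n,U_2^n$ vanish at all boundary positions: $U_{1,0,j+1/2}=U_{1,N_x,j+1/2}=0$, $U_{1,i,0}=U_{1,i,N_y}=0$, $U_{2,0,j}=U_{2,N_x,j}=0$, $U_{2,i+1/2,0}=U_{2,i+1/2,N_y}=0$ (the values at $y_0=y_{-1/2}$ etc. being those used in $D_yU_1$ and $D_xU_2$ on the boundary). Fully discrete scheme ($0\le n\le N-1$): at all $(x_{i+1/2},y_{j+1/2})$, $0\le i\le N_x-1$, $0\le j\le N_y-1$, $$[d_tZ]^{n+1}=M[d_xD_xW+d_yD_yW]^{n+1/2}-\mathcal{P}_h^y\mathcal{P}_h^x[U_1D_x\tilde Z+U_2D_y\tilde Z]^{n+1/2},$$ $$W^{n+1/2}=-\lambda[d_xD_xZ+d_yD_yZ]^{n+1/2}+\lambda\frac{R^{n+1/2}}{\sqrt{E_1^h(\tilde Z^{n+1/2})+\delta}}F'(\tilde Z^{n+1/2}),$$ $$[d_xU_1]^{n+1/2}+[d_yU_2]^{n+1/2}=0;$$ $$d_tR^{n+1}=\frac{1}{2\sqrt{E_1^h(\tilde Z^{n+1/2})+\delta}}(F'(\tilde Z^{n+1/2}),d_tZ^{n+1})_{l^2,M};$$ at $(x_i,y_{j+1/2})$, $1\le i\le N_x-1$, $0\le j\le N_y-1$, $$[d_tU_1]^{n+1}+\tfrac{\gamma}{2}\big[\tilde U_1D_x(\mathcal{P}_h^xU_1)+\mathcal{P}_h^xd_x(U_1\tilde U_1)+\mathcal{P}_h^y(\mathcal{P}_h^x\tilde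 U_2D_yU_1)+d_y(\mathcal{P}_h^yU_1\,\mathcal{P}_h^x\tilde U_2)\big]^{n+1/2}$$ $$-\nu D_x(d_xU_1)^{n+1/2}-\nu d_y(D_yU_1)^{n+1/2}+[D_xP]^{n+1/2}=\mathcal{P}_h^xW^{n+1/2}[D_x\tilde Z]^{n+1/2};$$ at $(x_{i+1/2},y_j)$, $0\le i\le N_x-1$, $1\le j\le N_y-1$, $$[d_tU_2]^{n+1}+\tfrac{\gamma}{2}\big[\mathcal{P}_h^x(\mathcal{P}_h^y\tilde U_1D_xU_2)+d_x(\mathcal{P}_h^y\tilde U_1\,\mathcal{P}_h^xU_2)+\tilde U_2D_y(\mathcal{P}_h^yU_2)+\mathcal{P}_h^y(d_y(U_2\tilde U_2))\big]^{n+1/2}$$ $$-\nu D_y(d_yU_2)^{n+1/2}-\nu d_x(D_xU_2)^{n+1/2}+[D_yP]^{n+1/2}=\mathcal{P}_h^yW^{n+1/2}[D_y\tilde Z]^{n+1/2}.$$ *)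

(* Defs.v *)
From mathcomp Require Import all_boot all_order all_algebra.
From mathcomp Require Import all_classical all_reals all_analysis.

Set Implicit Arguments.
Unset Strict Implicit.
Unset Printing Implicit Defensive.

Import GRing.Theory Num.Theory numFieldNormedType.Exports.
Local Open Scope ring_scope.

(* Half-integer positions are addressed by doubled indices: along an axis with
   N cells, the index 2i stands for x_i (0 <= i <= N) and 2i+1 for x_{i+1/2}
   (0 <= i <= N-1), so valid indices are 0, ..., 2N.  A grid function is total
   on nat * nat, but only its values at the positions where the quantity lives
   (including its boundary positions) are ever used. *)
Notation gridfun R := (nat * nat -> R).

Record axis (R : realType) := Axis {
  axis_lo : R;
  axis_hi : R;
  ncells : nat;
  axis_lo_lt_hi : axis_lo < axis_hi;
  ncells_gt0 : (0 < ncells)%N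
}.

Section Axis.
Context {R : realType}.
Variable A : axis R.

Definition step : R := (axis_hi A - axis_lo A) / (ncells A)%:R.

Definition node (a : nat) : R := axis_lo A + a%:R * (step / 2).

(* The neighbours half a cell above and below; they stay at the end points,
   which is the convention x_{-1/2} = x_0 and x_{N+1/2} = x_N. *)
Definition nxt (a : nat) : nat := minn a.+1 (ncells A).*2.
Definition prv (a : nat) : nat := if a is b.+1 then b else 0%N.

Definition width (a : nat) : R := node (nxt a) - node (prv a).

End Axis.

Section Operators.
Context {R : realType}.
Variables X Y : axis R.
Implicit Types (f g H u : gridfun R) (p : nat * nat).

(* dx, dy are meant at odd indices (half-integer positions) in the direction of
   differentiation, Dx, Dy at even ones. *)
Definition dx f : gridfun R := fun p =>
  (f (nxt X p.1, p.2) - f (prv p.1, p.2)) / step X.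
Definition dy f : gridfun R := fun p =>
  (f (p.1, nxt Y p.2) - f (p.1, prv p.2)) / step Y.
Definition Dx f : gridfun R := fun p =>
  (f (nxt X p.1, p.2) - f (prv p.1, p.2)) / width X p.1.
Definition Dy f : gridfun R := fun p =>
  (f (p.1, nxt Y p.2) - f (p.1, prv p.2)) / width Y p.2.

(* In the scheme below, Px and Py are evaluated at an end point only inside
   products whose other factor vanishes there. *)
Definition Px f : gridfun R := fun p =>
  (f (prv p.1, p.2) + f (nxt X p.1, p.2)) / 2.
Definition Py f : gridfun R := fun p =>
  (f (p.1, prv p.2) + f (p.1, nxt Y p.2)) / 2.

Definition ipM f g : R :=
  \sum_(0 <= i < ncells X) \sum_(0 <= j < ncells Y)
    step X * step Y * f (i.*2.+1, j.*2.+1) * g (i.*2.+1, j.*2.+1).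
Definition ipTM f g : R :=
  \sum_(1 <= i < ncells X) \sum_(0 <= j < ncells Y)
    width X i.*2 * step Y * f (i.*2, j.*2.+1) * g (i.*2, j.*2.+1).
Definition ipMT f g : R :=
  \sum_(0 <= i < ncells X) \sum_(1 <= j < ncells Y)
    step X * width Y j.*2 * f (i.*2.+1, j.*2) * g (i.*2.+1, j.*2).
Definition ipTx f g : R :=
  \sum_(0 <= i < (ncells X).+1) \sum_(1 <= j < ncells Y)
    width X i.*2 * width Y j.*2 * f (i.*2, j.*2) * g (i.*2, j.*2).
Definition ipTy f g : R :=
  \sum_(1 <= i < ncells X) \sum_(0 <= j < (ncells Y).+1)
    width X i.*2 * width Y j.*2 * f (i.*2, j.*2) * g (i.*2, j.*2).

Definition sqnorm (ip : gridfun R -> gridfun R -> R) f : R := ip f f.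

Definition sqnorm_vec (u1 u2 : gridfun R) : R := sqnorm ipTM u1 + sqnorm ipMT u2.
Definition sqnorm_grad H : R := sqnorm ipTM (Dx H) + sqnorm ipMT (Dy H).
Definition sqnorm_gradvec (u1 u2 : gridfun R) : R :=
  sqnorm ipM (dx u1) + sqnorm ipTy (Dy u1) +
  sqnorm ipTx (Dx u2) + sqnorm ipM (dy u2).

End Operators.

Section Time.
Context {R : realType}.

(* ddt tau u n is [d_t u]^n, for n >= 1. *)
Definition ddt (tau : R) (u : nat -> R) (n : nat) : R := (u n - u n.-1) / tau.

(* u^{n+1/2} *)
Definition mid (u : nat -> R) (n : nat) : R := (u n + u n.+1) / 2.

(* u~^{n+1/2}, where um1 is the starting value u^{-1} *)
Definition extrap (um1 : R) (u : nat -> R) (n : nat) : R :=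
  3 / 2 * u n - 1 / 2 * (if n is m.+1 then u m else um1).

Definition gddt (tau : R) (f : nat -> gridfun R) n : gridfun R :=
  fun p => ddt tau (f^~ p) n.
Definition gmid (f : nat -> gridfun R) n : gridfun R :=
  fun p => mid (f^~ p) n.
Definition gextrap (fm1 : gridfun R) (f : nat -> gridfun R) n : gridfun R :=
  fun p => extrap (fm1 p) (f^~ p) n.

End Time.

Section Scheme.
Context {R : realType}.
Variables X Y : axis R.
Variables M nu lambda eps delta gamma : R.

Definition F (phi : R) : R := 1 / (4 * eps ^+ 2) * (1 - phi ^+ 2) ^+ 2.

Definition E1h (Z : gridfun R) : R := ipM X Y (F \o Z) (fun=> 1).

Definition energy (Z U1 U2 : nat -> gridfun R) (r : nat -> R) (n : nat) : R :=
  1 / 2 * sqnorm_vec X Y (U1 n) (U2 n) +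
  lambda * (1 / 2 * sqnorm_grad X Y (Z n) + r n ^+ 2).

Definition neumann (H : gridfun R) : Prop :=
  (forall j, (j < ncells Y)%N ->
     Dx X H (0%N, j.*2.+1) = 0 /\ Dx X H ((ncells X).*2, j.*2.+1) = 0) /\
  (forall i, (i < ncells X)%N ->
     Dy Y H (i.*2.+1, 0%N) = 0 /\ Dy Y H (i.*2.+1, (ncells Y).*2) = 0).

Definition no_slip (u1 u2 : gridfun R) : Prop :=
  [/\ forall j, (j < ncells Y)%N ->
        u1 (0%N, j.*2.+1) = 0 /\ u1 ((ncells X).*2, j.*2.+1) = 0,
      forall i, (i <= ncells X)%N ->
        u1 (i.*2, 0%N) = 0 /\ u1 (i.*2, (ncells Y).*2) = 0,
      forall j, (j <= ncells Y)%N ->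
        u2 (0%N, j.*2) = 0 /\ u2 ((ncells X).*2, j.*2) = 0 &
      forall i, (i < ncells X)%N ->
        u2 (i.*2.+1, 0%N) = 0 /\ u2 (i.*2.+1, (ncells Y).*2) = 0].

Local Notation dx := (dx X).
Local Notation dy := (dy Y).
Local Notation Dx := (Dx X).
Local Notation Dy := (Dy Y).
Local Notation Px := (Px X).
Local Notation Py := (Py Y).

(* One time step.  z, u1, u2, r are the values at level n+1/2; zt, u1t, u2t the
   extrapolated ones; w, q are W^{n+1/2}, P^{n+1/2}; dtz, dtu1, dtu2, dtr the
   difference quotients [d_t .]^{n+1}. *)
Definition scheme_step (z zt w q u1 u2 u1t u2t dtz dtu1 dtu2 : gridfun R)
    (r dtr : R) : Prop :=
  let s := Num.sqrt (E1h zt + delta) in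
  let F'zt : gridfun R := derive1 F \o zt in
  [/\ forall i j, (i < ncells X)%N -> (j < ncells Y)%N ->
        let c := (i.*2.+1, j.*2.+1) in
        [/\ dtz c = M * (dx (Dx w) c + dy (Dy w) c)
                    - (Px (u1 \* Dx zt) c + Py (u2 \* Dy zt) c),
            w c = - lambda * (dx (Dx z) c + dy (Dy z) c)
                  + lambda * (r / s) * F'zt c &
            dx u1 c + dy u2 c = 0],
      dtr = 1 / (2 * s) * ipM X Y F'zt dtz,
      forall i j, (0 < i < ncells X)%N -> (j < ncells Y)%N ->
        let c := (i.*2, j.*2.+1) in
        dtu1 c
        + gamma / 2 * (u1t c * Dx (Px u1) c + Px (dx (u1 \* u1t)) c
                       + Py (Px u2t \* Dy u1) c + dy (Py u1 \* Px u2t) c)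
        - nu * Dx (dx u1) c - nu * dy (Dy u1) c + Dx q c
        = Px w c * Dx zt c &
      forall i j, (i < ncells X)%N -> (0 < j < ncells Y)%N ->
        let c := (i.*2.+1, j.*2) in
        dtu2 c
        + gamma / 2 * (Px (Py u1t \* Dx u2) c + dx (Py u1t \* Px u2) c
                       + u2t c * Dy (Py u2) c + Py (dy (u2 \* u2t)) c)
        - nu * Dy (dy u2) c - nu * dx (Dx u2) c + Dy q c
        = Py w c * Dy zt c].

(* W n and P n stand for W^{n+1/2} and P^{n+1/2}; Zm1 is Z^{-1}, while
   U^{-1} = U^0. *)
Record sav_mac_solution (tau : R) (N : nat) (Zm1 : gridfun R)
    (Z W U1 U2 P : nat -> gridfun R) (r : nat -> R) : Prop := {
  sol_Z_neumann : forall n, (n <= N)%N -> neumann (Z n);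
  sol_W_neumann : forall n, (n < N)%N -> neumann (W n);
  sol_U_no_slip : forall n, (n <= N)%N -> no_slip (U1 n) (U2 n);
  sol_step : forall n, (n < N)%N ->
    scheme_step (gmid Z n) (gextrap Zm1 Z n) (W n) (P n)
      (gmid U1 n) (gmid U2 n)
      (gextrap (U1 0%N) U1 n) (gextrap (U2 0%N) U2 n)
      (gddt tau Z n.+1) (gddt tau U1 n.+1) (gddt tau U2 n.+1)
      (mid r n) (ddt tau r n.+1)
}.

End Scheme.

(* Main.v *)
Require Import Defs.
From mathcomp Require Import all_boot all_order all_algebra.
From mathcomp Require Import all_classical all_reals all_analysis.
From mathcomp Require Import ring zify.

Import Order.TTheory GRing.Theory Num.Theory numFieldNormedType.Exports.
Local Open Scope ring_scope.

(** The energy law is an exact identity because every cancellation of the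
continuous energy estimate survives on the staggered grid.

Test the momentum equations with the mid-level velocity, the transport equation
for the phase with [w], and the equation defining [w] with the difference
quotient of the phase.  The increments of the quadratic energies are exactly
[2 * tau] times a mid-level value paired with a difference quotient
([sqnorm_vec_increment], [sqnorm_grad_increment]); the same formula for [r ^ 2]
together with the auxiliary-variable equation turns the nonlinear potential into
the increment of [r ^ 2].

What remains are three forms of summation by parts on the grid, and a symmetry:
- centred differences between two interlaced grids are skew-adjoint, provided
  that the boundary terms vanish ([ipM_dx], [ipTM_dy]), so the viscous and
  diffusion terms become the dissipation and the pressure pairs with the
  divergence, which is zero;
- averaging between two interlaced grids is self-adjoint ([ipM_Px], [ipTM_Py]),
  so the work of the surface force in the momentum equation cancels the
  advection in the phase equation;
- combining the two, the advective and the conservative form of the convection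
  are negatives of each other when tested with the transported velocity
  ([convection_skew]), so their half-sum does no work;
- the two velocity components exchange roles when the axes are transposed
  ([tr]), so one momentum balance ([momentum_balance]) serves both. *)

(** * Summation by parts along one axis *)

(** The case [c = -1] is Abel summation and [c = 1] is its analogue for averages:
differencing and averaging between interlaced grids are moved across a sum by
the same shift of index. *)
Lemma sum_shift_by_parts (R : comPzRingType) (c : R) (a b : nat -> R) (n : nat) :
  \sum_(0 <= i < n.+1) (a i.+1 + c * a i) * b i =
  a n.+1 * b n + c * a 0%N * b 0%N
  + \sum_(0 <= i < n) a i.+1 * (b i + c * b i.+1).
Proof.
elim: n => [|n IHn]; first by rewrite big_nat1 big_geq//; ring.
by rewrite big_nat_recr//= IHn [in RHS]big_nat_recr//=; ring.
Qed.

Lemma sum_interior (R : nmodType) (G : nat -> R) (n : nat) :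
  G 0%N = 0 -> G n = 0 -> (0 < n)%N ->
  \sum_(0 <= i < n.+1) G i = \sum_(1 <= i < n) G i.
Proof.
move=> G0 Gn n_gt0; rewrite big_nat_recr//= Gn addr0.
by rewrite big_ltn// G0 add0r.
Qed.

Section Rows.
Context {R : realType}.
Variable X : axis R.
Implicit Types (f g : gridfun R).

Lemma step_neq0 : step X != 0.
Proof.
rewrite /step mulf_neq0//.
  by rewrite subr_eq0 gt_eqF// axis_lo_lt_hi.
by rewrite invr_eq0 pnatr_eq0 -lt0n ncells_gt0.
Qed.

Lemma nxt_odd i : (i < ncells X)%N -> nxt X i.*2.+1 = i.+1.*2.
Proof. rewrite /nxt; lia. Qed.

Lemma nxt_even i : (i < ncells X)%N -> nxt X i.*2 = i.*2.+1.
Proof. rewrite /nxt; lia. Qed.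

Lemma nxt_last : nxt X (ncells X).*2 = (ncells X).*2.
Proof. rewrite /nxt; lia. Qed.

Lemma width_interior i : (0 < i < ncells X)%N -> width X i.*2 = step X.
Proof.
case: i => // i /= ltiN.
by rewrite /width nxt_even// doubleS /= /node -!natr1; field.
Qed.

Lemma width_neq0 i : (i <= ncells X)%N -> width X i.*2 != 0.
Proof.
have s0 := step_neq0; have N0 := ncells_gt0 X.
have half0 : step X / 2 != 0 by rewrite mulf_neq0// invr_eq0 pnatr_eq0.
rewrite leq_eqVlt => /orP[/eqP->|ltiN].
  case: (ncells X) nxt_last N0 => // n + _; rewrite /width => ->.
  rewrite doubleS /= /node -!natr1.
  by rewrite (_ : _ - _ = step X / 2); [|field].
case: (posnP i) ltiN => [->|i_gt0] ltiN; last by rewrite width_interior// i_gt0.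
rewrite /width nxt_even// double0 /= /node.
by rewrite (_ : _ - _ = step X / 2); [|field].
Qed.

(** The boundary terms are explicit because two different conditions are used to
remove them: sometimes [g] vanishes at the end points, sometimes [f] does.  At
the end points [Dx X f] is the one-sided difference over a half cell; its
division by [width] cancels the half weight of the end points in the sum. *)
Lemma row_by_parts f g m :
  \sum_(0 <= i < ncells X) step X * dx X g (i.*2.+1, m) * f (i.*2.+1, m) =
  g ((ncells X).*2, m) * f ((ncells X).*2, m) - g (0%N, m) * f (0%N, m)
  - \sum_(0 <= i < (ncells X).+1) width X i.*2 * g (i.*2, m) * Dx X f (i.*2, m).
Proof.
have s0 := step_neq0.
transitivity (\sum_(0 <= i < ncells X)
    (g (i.+1.*2, m) + -1 * g (i.*2, m)) * f (i.*2.+1, m)).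
  apply: eq_big_nat => i /andP[_ ltiN].
  by rewrite /dx /= nxt_odd//; field.
have -> : \sum_(0 <= i < (ncells X).+1)
    width X i.*2 * g (i.*2, m) * Dx X f (i.*2, m) =
  \sum_(0 <= i < (ncells X).+1)
    g (i.*2, m) * (f (nxt X i.*2, m) - f (prv i.*2, m)).
  apply: eq_big_nat => i /andP[_ leiN].
  by have := width_neq0 i leiN; rewrite /Dx /= => w0; field.
have N0 := ncells_gt0 X.
rewrite big_nat_recr//= nxt_last.
case EN : (ncells X) N0 => [//|n] _.
rewrite [in RHS]big_nat_recl// double0 (nxt_even 0) ?EN// double0 /=.
rewrite (sum_shift_by_parts _ _ (fun i => g (i.*2, m)) (fun i => f (i.*2.+1, m))).
rewrite (@eq_big_nat _ _ _ 0 n (fun i => g (i.+1.*2, m) * (f (nxt X i.+1.*2, m)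
     - f (prv i.+1.*2, m))) (fun i => - (g (i.+1.*2, m) *
     (f (i.*2.+1, m) + -1 * f (i.+1.*2.+1, m))))); last first.
  move=> i /andP[_ ltin]; rewrite nxt_even ?EN ?ltnS//= doubleS; ring.
by rewrite sumrN doubleS /=; ring.
Qed.

Lemma row_average f g m :
  g (0%N, m) = 0 -> g ((ncells X).*2, m) = 0 ->
  \sum_(0 <= i < ncells X) step X * Px X g (i.*2.+1, m) * f (i.*2.+1, m) =
  \sum_(0 <= i < (ncells X).+1) width X i.*2 * g (i.*2, m) * Px X f (i.*2, m).
Proof.
move=> g0 gN; have N0 := ncells_gt0 X.
rewrite [RHS]sum_interior ?gN ?g0 ?mulr0 ?mul0r//.
transitivity (step X / 2 * \sum_(0 <= i < ncells X)
    (g (i.+1.*2, m) + 1 * g (i.*2, m)) * f (i.*2.+1, m)).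
  rewrite mulr_sumr; apply: eq_big_nat => i /andP[_ ltiN].
  by rewrite /Px /= nxt_odd//; field.
transitivity (step X / 2 * \sum_(1 <= i < ncells X)
    g (i.*2, m) * (f (i.-1.*2.+1, m) + 1 * f (i.*2.+1, m))); last first.
  rewrite mulr_sumr; apply: eq_big_nat => -[//|i] ltiN.
  by rewrite width_interior// /Px /= nxt_even// doubleS /=; field.
case EN : (ncells X) N0 gN => [//|n] _ gN.
rewrite (sum_shift_by_parts _ _ (fun i => g (i.*2, m)) (fun i => f (i.*2.+1, m))).
by rewrite gN double0 g0 big_add1 /=; ring.
Qed.

End Rows.

(** * Adjointness of the staggered operators *)

(** Transposing the axes turns every statement about differences in [x] into one
about differences in [y]: [Dy Y f] and [Dx Y (tr f)] are transposes of each
other by computation, so only the inner products need rewriting. *)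
Definition tr {R : realType} (f : gridfun R) : gridfun R :=
  fun p => f (p.2, p.1).

Section Adjoint.
Context {R : realType}.
Implicit Types (X Y : axis R) (f g h : gridfun R).

Lemma ipM_tr X Y f g : ipM X Y f g = ipM Y X (tr f) (tr g).
Proof.
rewrite /ipM exchange_big_nat; apply: eq_bigr => j _; apply: eq_bigr => i _.
by rewrite (mulrC (step Y)).
Qed.

Lemma ipMT_tr X Y f g : ipMT X Y f g = ipTM Y X (tr f) (tr g).
Proof.
rewrite /ipMT exchange_big_nat; apply: eq_bigr => j _; apply: eq_bigr => i _.
by rewrite (mulrC (width Y _)).
Qed.

Lemma ipTx_tr X Y f g : ipTx X Y f g = ipTy Y X (tr f) (tr g).
Proof.
rewrite /ipTx exchange_big_nat; apply: eq_bigr => j _; apply: eq_bigr => i _.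
by rewrite (mulrC (width Y _)).
Qed.

Lemma ipMC X Y f g : ipM X Y f g = ipM X Y g f.
Proof.
by apply: eq_bigr => i _; apply: eq_bigr => j _; rewrite mulrAC.
Qed.

Lemma ipTMC X Y f g : ipTM X Y f g = ipTM X Y g f.
Proof.
by apply: eq_bigr => i _; apply: eq_bigr => j _; rewrite mulrAC.
Qed.

Lemma ipMD X Y f g h : ipM X Y (f + g) h = ipM X Y f h + ipM X Y g h.
Proof.
rewrite /ipM -big_split; apply: eq_bigr => i _; rewrite -big_split.
by apply: eq_bigr => j _; rewrite fctE /=; ring.
Qed.

Lemma ipMZ X Y (a : R) f h : ipM X Y (a *: f) h = a * ipM X Y f h.
Proof.
rewrite /ipM mulr_sumr; apply: eq_bigr => i _; rewrite mulr_sumr.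
by apply: eq_bigr => j _; rewrite fctE /GRing.scale /=; ring.
Qed.

Lemma ipTMD X Y f g h : ipTM X Y (f + g) h = ipTM X Y f h + ipTM X Y g h.
Proof.
rewrite /ipTM -big_split; apply: eq_bigr => i _; rewrite -big_split.
by apply: eq_bigr => j _; rewrite fctE /=; ring.
Qed.

Lemma ipTMZ X Y (a : R) f h : ipTM X Y (a *: f) h = a * ipTM X Y f h.
Proof.
rewrite /ipTM mulr_sumr; apply: eq_bigr => i _; rewrite mulr_sumr.
by apply: eq_bigr => j _; rewrite fctE /GRing.scale /=; ring.
Qed.

Lemma eq_ipM X Y f g h :
  (forall i j, (i < ncells X)%N -> (j < ncells Y)%N ->
     f (i.*2.+1, j.*2.+1) = g (i.*2.+1, j.*2.+1)) ->
  ipM X Y f h = ipM X Y g h.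
Proof.
move=> fg; apply: eq_big_nat => i ltiN; apply: eq_big_nat => j ltjN.
by rewrite fg.
Qed.

Lemma eq_ipTM X Y f g h :
  (forall i j, (0 < i < ncells X)%N -> (j < ncells Y)%N ->
     f (i.*2, j.*2.+1) = g (i.*2, j.*2.+1)) ->
  ipTM X Y f h = ipTM X Y g h.
Proof.
move=> fg; apply: eq_big_nat => i ltiN; apply: eq_big_nat => j ltjN.
by rewrite fg.
Qed.

(** The condition is placed on the rows of cell midpoints, where the horizontal
velocity and the horizontal fluxes of cell-centred quantities live. *)
Definition vanish_left_right X Y g : Prop :=
  forall j, (j < ncells Y)%N ->
    g (0%N, j.*2.+1) = 0 /\ g ((ncells X).*2, j.*2.+1) = 0.

(** Only interior abscissas occur: these are the ends of the vertical grid lines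
that carry the horizontal velocity in the momentum equation. *)
Definition vanish_bottom_top X Y g : Prop :=
  forall i, (0 < i < ncells X)%N ->
    g (i.*2, 0%N) = 0 /\ g (i.*2, (ncells Y).*2) = 0.

Lemma ipM_dx X Y f g : vanish_left_right X Y g ->
  ipM X Y (dx X g) f = - ipTM X Y g (Dx X f).
Proof.
move=> gb; rewrite /ipM /ipTM exchange_big_nat [in RHS]exchange_big_nat.
rewrite -sumrN; apply: eq_big_nat => j /gb[g0 gN].
transitivity (step Y * \sum_(0 <= i < ncells X)
    step X * dx X g (i.*2.+1, j.*2.+1) * f (i.*2.+1, j.*2.+1)).
  by rewrite mulr_sumr; apply: eq_bigr => i _; ring.
rewrite row_by_parts g0 gN !mul0r subr0 sub0r.
rewrite sum_interior ?g0 ?gN ?mulr0 ?mul0r ?ncells_gt0//.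
by rewrite mulrN mulr_sumr; congr (- _); apply: eq_bigr => i _; ring.
Qed.

Lemma ipM_Px X Y f g : vanish_left_right X Y g ->
  ipM X Y (Px X g) f = ipTM X Y g (Px X f).
Proof.
move=> gb; rewrite /ipM /ipTM exchange_big_nat [in RHS]exchange_big_nat.
apply: eq_big_nat => j /gb[g0 gN].
transitivity (step Y * \sum_(0 <= i < ncells X)
    step X * Px X g (i.*2.+1, j.*2.+1) * f (i.*2.+1, j.*2.+1)).
  by rewrite mulr_sumr; apply: eq_bigr => i _; ring.
rewrite row_average//.
rewrite sum_interior ?g0 ?gN ?mulr0 ?mul0r ?ncells_gt0//.
by rewrite mulr_sumr; apply: eq_bigr => i _; ring.
Qed.

(** Here the condition bears on [f], not on [g]: with [f] the horizontal velocity
and [g] its vertical shear, the shear does not vanish at the walls, and its wall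
values are kept in the half-cell terms of [ipTy]. *)
Lemma ipTM_dy X Y f g : vanish_bottom_top X Y f ->
  ipTM X Y (dy Y g) f = - ipTy X Y g (Dy Y f).
Proof.
move=> fb; rewrite /ipTM /ipTy -sumrN; apply: eq_big_nat => i /fb[f0 fN].
transitivity (width X i.*2 * \sum_(0 <= j < ncells Y)
    step Y * dx Y (tr g) (j.*2.+1, i.*2) * tr f (j.*2.+1, i.*2)).
  by rewrite mulr_sumr; apply: eq_bigr => j _; rewrite !mulrA.
rewrite row_by_parts (f0 : tr f (0%N, _) = 0) (fN : tr f (_, i.*2) = 0).
rewrite !mulr0 subrr sub0r mulrN mulr_sumr.
by congr (- _); apply: eq_bigr => j _; rewrite !mulrA.
Qed.

Lemma ipTM_Py X Y f g : vanish_bottom_top X Y g ->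
  ipTM X Y (Py Y g) f = ipTy X Y g (Py Y f).
Proof.
move=> gb; rewrite /ipTM /ipTy; apply: eq_big_nat => i /gb[g0 gN].
transitivity (width X i.*2 * \sum_(0 <= j < ncells Y)
    step Y * Px Y (tr g) (j.*2.+1, i.*2) * tr f (j.*2.+1, i.*2)).
  by rewrite mulr_sumr; apply: eq_bigr => j _; rewrite !mulrA.
rewrite row_average// mulr_sumr.
by apply: eq_bigr => j _; rewrite !mulrA.
Qed.

Lemma ipM_dy X Y f g : vanish_left_right Y X (tr g) ->
  ipM X Y (dy Y g) f = - ipMT X Y g (Dy Y f).
Proof. by move=> gb; rewrite ipM_tr ipMT_tr; exact: ipM_dx. Qed.

End Adjoint.

(** * Energy balances *)

Section Balance.
Context {R : realType}.
Implicit Types (X Y : axis R) (f g : gridfun R).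

(** The first two terms cancel each other through [ipM_Px] and [ipM_dx], the last
two through [ipTM_Py] and [ipTM_dy].  The cancellation is algebraic, so it holds for
the extrapolated transporting velocity, whose wall values alone matter. *)
Lemma convection_skew X Y (u ut vt : gridfun R) :
  vanish_left_right X Y u -> vanish_bottom_top X Y u ->
  vanish_bottom_top X Y (Px X vt) ->
  ipTM X Y (ut \* Dx X (Px X u)) u + ipTM X Y (Px X (dx X (u \* ut))) u
  + ipTM X Y (Py Y (Px X vt \* Dy Y u)) u
  + ipTM X Y (dy Y (Py Y u \* Px X vt)) u = 0.
Proof.
move=> u_lr u_bt v_bt.
have uut_lr : vanish_left_right X Y (u \* ut).
  by move=> j /u_lr[u0 uN]; rewrite /= u0 uN !mul0r.
have vDu_bt : vanish_bottom_top X Y (Px X vt \* Dy Y u).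
  by move=> i /v_bt[v0 vN]; rewrite /= v0 vN !mul0r.
have -> : ipTM X Y (Px X (dx X (u \* ut))) u =
          - ipTM X Y (ut \* Dx X (Px X u)) u.
  rewrite ipTMC -ipM_Px// ipMC ipM_dx//; congr (- _).
  by apply: eq_bigr => i _; apply: eq_bigr => j _ /=; ring.
have -> : ipTM X Y (Py Y (Px X vt \* Dy Y u)) u =
          - ipTM X Y (dy Y (Py Y u \* Px X vt)) u.
  rewrite ipTM_Py// ipTM_dy// opprK.
  by apply: eq_bigr => i _; apply: eq_bigr => j _ /=; ring.
by ring.
Qed.

(** The kinetic energy produced in one step is the work of the pressure, minus
the viscous dissipation, plus the work of the surface force.  The latter is
written with [u \* Dx X zt] averaged to the cells, the form in which the
advection of the phase appears. *)
Lemma momentum_balance X Y (nu gamma : R) (w q u ut vt du zt : gridfun R) :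
  vanish_left_right X Y u -> vanish_bottom_top X Y u ->
  vanish_bottom_top X Y (Px X vt) ->
  (forall i j, (0 < i < ncells X)%N -> (j < ncells Y)%N ->
     let c := (i.*2, j.*2.+1) in
     du c
     + gamma / 2 * (ut c * Dx X (Px X u) c + Px X (dx X (u \* ut)) c
                    + Py Y (Px X vt \* Dy Y u) c + dy Y (Py Y u \* Px X vt) c)
     - nu * Dx X (dx X u) c - nu * dy Y (Dy Y u) c + Dx X q c
     = Px X w c * Dx X zt c) ->
  ipTM X Y du u =
    ipM X Y (dx X u) q
    - nu * (sqnorm (ipM X Y) (dx X u) + sqnorm (ipTy X Y) (Dy Y u))
    + ipM X Y (Px X (u \* Dx X zt)) w.
Proof.
move=> u_lr u_bt v_bt eqn.
have uDz_lr : vanish_left_right X Y (u \* Dx X zt).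
  by move=> j /u_lr[u0 uN]; rewrite /= u0 uN !mul0r.
(* The momentum equation as an identity of grid functions, so that bilinearity
   separates its terms. *)
have tested : ipTM X Y (du + (gamma / 2) *: ((ut \* Dx X (Px X u))
    + Px X (dx X (u \* ut)) + Py Y (Px X vt \* Dy Y u)
    + dy Y (Py Y u \* Px X vt)) + (- nu) *: Dx X (dx X u)
    + (- nu) *: dy Y (Dy Y u) + Dx X q) u
  = ipTM X Y (Px X w \* Dx X zt) u.
  apply: eq_ipTM => i j Hi Hj; rewrite /= -(eqn i j Hi Hj) !fctE /GRing.scale /=.
  by ring.
move: tested; rewrite !(ipTMD, ipTMZ) convection_skew//.
rewrite (ipTMC _ _ (Dx X (dx X u)) u) (ipTMC _ _ (Dx X q) u).
have -> : ipTM X Y (Px X w \* Dx X zt) u = ipM X Y (Px X (u \* Dx X zt)) w.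
  rewrite ipM_Px//.
  by apply: eq_bigr => i _; apply: eq_bigr => j _ /=; ring.
rewrite ipTM_dy// ipM_dx// /sqnorm [in X in _ - nu * X]ipM_dx// => <-.
by ring.
Qed.

(** The difference of squares [a ^ 2 - b ^ 2] factors as mean times difference;
this is why a Crank-Nicolson step produces no numerical dissipation. *)
Lemma sqnorm_increment X Y (tau : R) (f : nat -> gridfun R) n : tau != 0 ->
  sqnorm (ipTM X Y) (f n.+1) - sqnorm (ipTM X Y) (f n) =
  2 * tau * ipTM X Y (gmid f n) (gddt tau f n.+1).
Proof.
move=> tau0; rewrite /sqnorm /ipTM -sumrB mulr_sumr; apply: eq_bigr => i _.
rewrite -sumrB mulr_sumr; apply: eq_bigr => j _.
by rewrite /gmid /gddt /mid /ddt /=; field.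
Qed.

End Balance.

(** * The discrete energy law *)

Section OneStep.
Context {R : realType}.
Implicit Types (f g H u v : gridfun R).

Lemma no_slip_tr X Y u v : no_slip X Y u v -> no_slip Y X (tr v) (tr u).
Proof. by case. Qed.

Lemma no_slip_left_right X Y u v : no_slip X Y u v -> vanish_left_right X Y u.
Proof. by case. Qed.

Lemma no_slip_bottom_top X Y u v : no_slip X Y u v -> vanish_bottom_top X Y u.
Proof. by case=> _ ub _ _ i /andP[_ /ltnW]; exact: ub. Qed.

Lemma no_slip_Px_bottom_top X Y u v :
  no_slip X Y u v -> vanish_bottom_top X Y (Px X v).
Proof.
case=> _ _ _ vb [//|i] /= ltiN.
have [l0 lN] := vb i (ltnW ltiN); have [r0 rN] := vb i.+1 ltiN.
by rewrite /Px /= nxt_even// doubleS /= l0 lN r0 rN addr0 mul0r.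
Qed.

Variables X Y : axis R.

Lemma no_slip_gmid (u v : nat -> gridfun R) n :
  no_slip X Y (u n) (v n) -> no_slip X Y (u n.+1) (v n.+1) ->
  no_slip X Y (gmid u n) (gmid v n).
Proof.
case=> a1 b1 c1 d1 [a2 b2 c2 d2]; rewrite /gmid /mid; split=> i Hi /=.
- by have [-> ->] := a1 i Hi; have [-> ->] := a2 i Hi; rewrite addr0 mul0r.
- by have [-> ->] := b1 i Hi; have [-> ->] := b2 i Hi; rewrite addr0 mul0r.
- by have [-> ->] := c1 i Hi; have [-> ->] := c2 i Hi; rewrite addr0 mul0r.
- by have [-> ->] := d1 i Hi; have [-> ->] := d2 i Hi; rewrite addr0 mul0r.
Qed.

(** The truncated predecessor covers the first step, where the starting value
[U^{-1}] equals [U^0]. *)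
Lemma no_slip_gextrap (u v : nat -> gridfun R) n :
  no_slip X Y (u n) (v n) -> no_slip X Y (u n.-1) (v n.-1) ->
  no_slip X Y (gextrap (u 0%N) u n) (gextrap (v 0%N) v n).
Proof.
have E (f : nat -> gridfun R) : gextrap (f 0%N) f n =
    fun p => 3 / 2 * f n p - 1 / 2 * f n.-1 p by case: n.
rewrite !E; case=> a1 b1 c1 d1 [a2 b2 c2 d2]; split=> i Hi.
- by have [-> ->] := a1 i Hi; have [-> ->] := a2 i Hi; rewrite !mulr0 subrr.
- by have [-> ->] := b1 i Hi; have [-> ->] := b2 i Hi; rewrite !mulr0 subrr.
- by have [-> ->] := c1 i Hi; have [-> ->] := c2 i Hi; rewrite !mulr0 subrr.
- by have [-> ->] := d1 i Hi; have [-> ->] := d2 i Hi; rewrite !mulr0 subrr.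
Qed.

Lemma Dx_gmid (f : nat -> gridfun R) n :
  Dx X (gmid f n) = gmid (fun m => Dx X (f m)) n.
Proof. by apply/funext => p; rewrite /Dx /gmid /mid; ring. Qed.

Lemma Dx_gddt (tau : R) (f : nat -> gridfun R) n :
  Dx X (gddt tau f n) = gddt tau (fun m => Dx X (f m)) n.
Proof. by apply/funext => p; rewrite /Dx /gddt /ddt; ring. Qed.

Lemma Dy_gmid (f : nat -> gridfun R) n :
  Dy Y (gmid f n) = gmid (fun m => Dy Y (f m)) n.
Proof. by apply/funext => p; rewrite /Dy /gmid /mid; ring. Qed.

Lemma Dy_gddt (tau : R) (f : nat -> gridfun R) n :
  Dy Y (gddt tau f n) = gddt tau (fun m => Dy Y (f m)) n.
Proof. by apply/funext => p; rewrite /Dy /gddt /ddt; ring. Qed.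

Lemma neumann_gmid (f : nat -> gridfun R) n :
  neumann X Y (f n) -> neumann X Y (f n.+1) -> neumann X Y (gmid f n).
Proof.
case=> a1 b1 [a2 b2]; rewrite /neumann Dx_gmid Dy_gmid /gmid /mid.
split=> i Hi.
- by have [-> ->] := a1 i Hi; have [-> ->] := a2 i Hi; rewrite addr0 mul0r.
- by have [-> ->] := b1 i Hi; have [-> ->] := b2 i Hi; rewrite addr0 mul0r.
Qed.

Lemma ipM_laplacian H f : neumann X Y H ->
  ipM X Y (dx X (Dx X H) + dy Y (Dy Y H)) f =
  - (ipTM X Y (Dx X H) (Dx X f) + ipMT X Y (Dy Y H) (Dy Y f)).
Proof. by case=> Hlr Hbt; rewrite ipMD ipM_dx// ipM_dy// opprD. Qed.

Lemma sqnorm_vec_increment (tau : R) (u v : nat -> gridfun R) n : tau != 0 ->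
  sqnorm_vec X Y (u n.+1) (v n.+1) - sqnorm_vec X Y (u n) (v n) =
  2 * tau * (ipTM X Y (gmid u n) (gddt tau u n.+1)
             + ipMT X Y (gmid v n) (gddt tau v n.+1)).
Proof.
move=> tau0; rewrite /sqnorm_vec opprD addrACA (sqnorm_increment _ _ tau)//.
rewrite /sqnorm !ipMT_tr mulrDr; congr (_ + _).
exact: (sqnorm_increment Y X tau (fun m => tr (v m))).
Qed.

Lemma sqnorm_grad_increment (tau : R) (f : nat -> gridfun R) n : tau != 0 ->
  sqnorm_grad X Y (f n.+1) - sqnorm_grad X Y (f n) =
  2 * tau * (ipTM X Y (Dx X (gmid f n)) (Dx X (gddt tau f n.+1))
             + ipMT X Y (Dy Y (gmid f n)) (Dy Y (gddt tau f n.+1))).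
Proof.
move=> tau0; rewrite Dx_gmid Dx_gddt Dy_gmid Dy_gddt.
exact: (sqnorm_vec_increment _ (fun m => Dx X (f m)) (fun m => Dy Y (f m))).
Qed.

(** The energy law before multiplication by the time step.  The two momentum
balances leave the work of the surface force, and the phase equation tested with
[w] leaves its opposite; adding them gives the dissipation, the pressure
contributing nothing because the velocity is discretely solenoidal. *)
Lemma scheme_step_balance (M nu lambda eps delta gamma : R)
    (z zt w q u1 u2 u1t u2t dtz dtu1 dtu2 : gridfun R) (r dtr : R) :
  neumann X Y z -> neumann X Y w ->
  no_slip X Y u1 u2 -> no_slip X Y u1t u2t ->
  scheme_step X Y M nu lambda eps delta gamma
    z zt w q u1 u2 u1t u2t dtz dtu1 dtu2 r dtr ->
  ipTM X Y u1 dtu1 + ipMT X Y u2 dtu2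
  + lambda * (ipTM X Y (Dx X z) (Dx X dtz) + ipMT X Y (Dy Y z) (Dy Y dtz)
              + 2 * r * dtr)
  = - M * sqnorm_grad X Y w - nu * sqnorm_gradvec X Y u1 u2.
Proof.
move=> z_bc w_bc u_bc ut_bc [cells dtrE mom1 mom2].
have transport : ipM X Y dtz w = - M * sqnorm_grad X Y w
    - (ipM X Y (Px X (u1 \* Dx X zt)) w + ipM X Y (Py Y (u2 \* Dy Y zt)) w).
  rewrite (@eq_ipM _ X Y _ (M *: (dx X (Dx X w) + dy Y (Dy Y w))
      + (-1) *: (Px X (u1 \* Dx X zt) + Py Y (u2 \* Dy Y zt)))); last first.
    move=> i j Hi Hj; have [-> _ _] := cells i j Hi Hj.
    by rewrite !fctE /GRing.scale /=; ring.
  by rewrite ipMD !ipMZ ipM_laplacian// ipMD /sqnorm_grad /sqnorm; ring.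
have potential : ipM X Y dtz w =
    lambda * (ipTM X Y (Dx X z) (Dx X dtz) + ipMT X Y (Dy Y z) (Dy Y dtz)
              + 2 * r * dtr).
  rewrite ipMC (@eq_ipM _ X Y _ ((- lambda) *: (dx X (Dx X z) + dy Y (Dy Y z))
      + (lambda * (r / Num.sqrt (E1h X Y eps zt + delta)))
        *: (derive1 (F eps) \o zt))); last first.
    move=> i j Hi Hj; have [_ -> _] := cells i j Hi Hj.
    by rewrite !fctE /GRing.scale /=.
  rewrite ipMD !ipMZ ipM_laplacian// dtrE div1r invfM.
  (* The factor 2 in [2 * r * dtr] absorbs the 1/2 of the equation for [dtr]; the
     inverse square root is a common factor, here an atom [sinv]. *)
  by move: (Num.sqrt _)^-1 => sinv; field.
have incompressible : ipM X Y (dx X u1) q + ipM X Y (dy Y u2) q = 0.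
  rewrite -ipMD (@eq_ipM _ X Y _ (0 *: q)); first by rewrite ipMZ mul0r.
  move=> i j Hi Hj; have [_ _ div0] := cells i j Hi Hj.
  by rewrite !fctE /GRing.scale /= div0 mul0r.
have balance1 := momentum_balance _ _ _ _ _ _ _ _ _ _ _
  (no_slip_left_right _ _ _ _ u_bc) (no_slip_bottom_top _ _ _ _ u_bc)
  (no_slip_Px_bottom_top _ _ _ _ ut_bc) mom1.
have balance2 : ipMT X Y u2 dtu2 = ipM X Y (dy Y u2) q
    - nu * (sqnorm (ipM X Y) (dy Y u2) + sqnorm (ipTx X Y) (Dx X u2))
    + ipM X Y (Py Y (u2 \* Dy Y zt)) w.
  rewrite /sqnorm ipMT_tr ipTMC !(ipM_tr X Y) ipTx_tr.
  apply: (momentum_balance Y X nu gamma (tr w) (tr q) (tr u2) (tr u2t) (tr u1t)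
    (tr dtu2) (tr zt)
    (no_slip_left_right _ _ _ _ (no_slip_tr _ _ _ _ u_bc))
    (no_slip_bottom_top _ _ _ _ (no_slip_tr _ _ _ _ u_bc))
    (no_slip_Px_bottom_top _ _ _ _ (no_slip_tr _ _ _ _ ut_bc))).
  (* The two equations differ only by the order of the convection terms. *)
  move=> j i Hj Hi; have := mom2 i j Hi Hj => /=.
  have -> : Py Y u1t \* Px X u2 = Px X u2 \* Py Y u1t.
    by apply/funext => p /=; rewrite mulrC.
  rewrite -[X in gamma / 2 * X]addrA [X in gamma / 2 * X]addrC.
  rewrite [X in gamma / 2 * X]addrA; exact.
rewrite ipTMC balance1 balance2 -potential transport /sqnorm_gradvec.
move: incompressible => /eqP; rewrite addr_eq0 => /eqP ->.
by ring.
Qed.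

End OneStep.

Theorem theorem3p3 (R : realType) (X Y : axis R)
    (M nu lambda eps delta gamma T : R) (N : nat)
    (Zm1 : gridfun R) (Z W U1 U2 P : nat -> gridfun R) (r : nat -> R)
    (M_gt0 : 0 < M) (nu_gt0 : 0 < nu) (lambda_gt0 : 0 < lambda)
    (eps_gt0 : 0 < eps) (delta_gt0 : 0 < delta)
    (gamma01 : gamma = 0 \/ gamma = 1)
    (T_gt0 : 0 < T) (N_gt0 : (0 < N)%N) :
  let tau := T / N%:R in
  sav_mac_solution X Y M nu lambda eps delta gamma tau N Zm1 Z W U1 U2 P r ->
  forall n : nat, (n < N)%N ->
    energy X Y lambda Z U1 U2 r n.+1 - energy X Y lambda Z U1 U2 r n
    = - M * tau * sqnorm_grad X Y (W n)
      - nu * tau * sqnorm_gradvec X Y (gmid U1 n) (gmid U2 n).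
Proof.
move=> tau [Zbc Wbc Ubc step] n ltnN.
have tau0 : tau != 0 by rewrite mulf_neq0 ?invr_eq0 ?pnatr_eq0 -?lt0n// gt_eqF.
have lenN := ltnW ltnN.
have := scheme_step_balance _ _ _ _ _ _ _ _ _ _ _ _ _ _ _ _ _ _ _ _ _
  (neumann_gmid _ _ _ _ (Zbc n lenN) (Zbc n.+1 ltnN)) (Wbc n ltnN)
  (no_slip_gmid _ _ _ _ _ (Ubc n lenN) (Ubc n.+1 ltnN))
  (no_slip_gextrap _ _ _ _ _ (Ubc n lenN) (Ubc n.-1 (leq_trans (leq_pred n) lenN)))
  (step n ltnN).
set K := _ + ipMT _ _ (gmid U2 n) _; set G := _ + ipMT _ _ (Dy _ _) _.
move=> balance.
transitivity (tau * (K + lambda * (G + 2 * mid r n * ddt tau r n.+1))); last first.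
  by rewrite balance; ring.
have kinetic := sqnorm_vec_increment X Y _ U1 U2 n tau0.
have gradient := sqnorm_grad_increment X Y _ Z n tau0.
transitivity (1 / 2 * (2 * tau * K) + lambda * (1 / 2 * (2 * tau * G)
    + (r n.+1 ^+ 2 - r n ^+ 2))).
  by rewrite -kinetic -gradient /energy; ring.
by rewrite /mid /ddt /=; field.
Qed.
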